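(* Let $M$ be a locally compact separable metric space, $m$ a positive Radon measure on $M$ with full support, and $(\mathcal E,\mathcal H)$ a Dirichlet form on $L^2(m)$ satisfying $(\mathcal E.1)$ and $(\mathcal E.2)$ with constant $\alpha_0\in\mathbb R$. Let $\mathcal E^a$ be an antisymmetric bilinear form on $\mathcal H$ for which there is $K<\infty$ with $$|\mathcal E^a(u,v)|\le K\mathcal E_{\alpha_0+1}(u,u)^{1/2}\mathcal E_{\alpha_0+1}(v,v)^{1/2}\qquad\text{for all }u,v\in\mathcal H,$$ and set $\mathcal E^\kappa:=\mathcal E+\kappa\mathcal E^a$ for $\kappa\in\mathbb R$. Let $\widetilde M$ be a locally compact separable metric space, $\pi:M\to\widetilde M$ a measurable map, and $\widetilde m:=\pi_*m$, with $\mathrm{Supp}[\widetilde m]=\widetilde M$. Set $$\widetilde{\mathcal H}=\{\widetilde u\in L^2(\widetilde m):\ \widetilde u\circ\pi\in\mathcal H\},\qquad \widetilde{\mathcal E}(\widetilde u,\widetilde v)=\mathcal E(\widetilde u\circ\pi,\widetilde v\circ\pi),\quad \widetilde u,\widetilde v\in\widetilde{\mathcal H},$$ and assume $\widetilde{\mathcal H}$ is dense in $L^2(\widetilde m)$. Assume that for all $u\in\mathcal H$, $$\big(\mathcal E^a(u,v)=0\ \ \forall v\in\mathcal H\big)\iff\big(\exists\,\widetilde u\in\widetilde{\mathcal H}\text{ such that }u=\widetilde u\circ\pi\big).$$ Then, as $\kappa\to\infty$, $(\mathcal E^\kappa,\mathcal H)$ Mosco-converges to $(\widetilde{\mathcal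 E},\widetilde{\mathcal H})$, where the Hilbert spaces $\mathcal L_\kappa:=L^2(m)$ converge to $\mathcal L:=L^2(\widetilde m)$ via $\Phi_\kappa\widetilde f=\widetilde f\circ\pi$.
   Context: **Closed forms and Dirichlet forms.** A bilinear form $\mathcal E$ on a real separable Hilbert space $\mathcal L$ with dense linear domain $\mathcal H$ is a *bilinear closed form* with constant $\alpha_0$ if, writing $\mathcal E^s$ for its symmetric part, $\mathcal E_\alpha=\mathcal E+\alpha\langle\cdot,\cdot\rangle_{\mathcal L}$ and $\mathcal E^s_\alpha=\mathcal E^s+\alpha\langle\cdot,\cdot\rangle_{\mathcal L}$: $(\mathcal E.1)$ $\mathcal E^s_{\alpha_0}(u,u)\ge0$ for all $u\in\mathcal H$ and $\mathcal H$ is a Hilbert space for the inner product $\mathcal E^s_{\alpha_0+1}$; $(\mathcal E.2)$ there is $K\ge1$ with $|\mathcal E_{\alpha_0+1}(u,v)|\le K\mathcal E_{\alpha_0+1}(u,u)^{1/2}\mathcal E_{\alpha_0+1}(v,v)^{1/2}$ on $\mathcal H$. A *Dirichlet form* on $L^2(m)$ is a bilinear closed form on $\mathcal L=L^2(m)$ that also satisfies $(\mathcal E.3)$: for all $u\in\mathcal H$, $a\ge0$: $u\wedge a\in\mathcal H$ and $\mathcal E(u\wedge a,u-u\wedge a)\ge0$. Here $\mathcal E^a$ is an arbitrary antisymmetric form with the stated bound (not necessarily the antisymmetric part of $\mathcal E$). **Mosco convergence.** ''As $\kappa\to\infty$'' means: for every sequence $\kappa_n\uparrow\infty$, with $\mathcal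 L_n=L^2(m)$, $\mathcal H_n=\mathcal H$, $\mathcal E^n=\mathcal E^{\kappa_n}$, $\Phi_n\widetilde f=\widetilde f\circ\pi$, $\mathcal L=L^2(\widetilde m)$, conditions (F1) and (F2) below hold with limit form $(\widetilde{\mathcal E},\widetilde{\mathcal H})$. For $u_n\in\mathcal L_n$, $\widetilde u\in\mathcal L$: $(u_n)$ *strongly converges* to $\widetilde u$ if $\|\Phi_n\widetilde u-u_n\|_{\mathcal L_n}\to0$; *weakly converges* to $\widetilde u$ if $\langle u_n,v_n\rangle_{\mathcal L_n}\to\langle\widetilde u,\widetilde v\rangle_{\mathcal L}$ for every $(v_n)$ strongly converging to some $\widetilde v\in\mathcal L$. Let $\Theta^n(u)=\sup\{\mathcal E^n_{\alpha_0+1}(v,u): v\in\mathcal H,\ \mathcal E^n_{\alpha_0+1}(v,v)=1\}$. - (F1) If $u_n\in\mathcal H_n$ weakly converges to $\widetilde u\in\mathcal L$ and $\liminf_n\Theta^n(u_n)<\infty$, then $\widetilde u\in\widetilde{\mathcal H}$. - (F2) For any $u_n\in\mathcal H_n$ weakly converging to some $\widetilde u\in\widetilde{\mathcal H}$ and any $\widetilde v\in\widetilde{\mathcal H}$ there is $v_n\in\mathcal H_n$ strongly converging to $\widetilde v$ with $\lim_n\mathcal E^n(v_n,u_n)=\widetilde{\mathcal E}(\widetilde v,\widetilde u)$. *)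

(* Defs.v *)
From HB Require Import structures.
From mathcomp Require Import all_boot all_order all_algebra.
From mathcomp Require Import all_classical all_reals all_analysis.
From mathcomp Require Import measurable_realfun ess_sup_inf.

Set Implicit Arguments.
Unset Strict Implicit.
Unset Printing Implicit Defensive.

Import Order.TTheory GRing.Theory Num.Theory.
Import numFieldNormedType.Exports.

Local Open Scope classical_set_scope.
Local Open Scope ring_scope.

(* The classes in LspaceType mu p1 are quotient elements without algebraic
   structure in the library. They coerce to functions through a chosen
   representative, so every identity below between a class and a function only
   holds almost everywhere. *)

Section Lspace_of.
Context d (T : measurableType d) (R : realType).
Variables (mu : {measure set T -> \bar R}) (p : \bar R) (p1 : (1 <= p)%E).
Implicit Types (f g : T -> R) (u v w : LspaceType mu p1).

Lemma LfunE f : (f \in Lfun mu p) = `[< measurable_fun setT f /\ finite_norm mu p f >].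
Proof.
apply/idP/asboolP => [/andP[/set_mem mf /set_mem ff]|[mf ff]]; first by split.
by apply/andP; split; rewrite inE.
Qed.

Lemma ae_eq_Lnorm f g : measurable_fun setT f -> measurable_fun setT g ->
  f = g %[ae mu] -> ('N[mu]_p[EFin \o f] = 'N[mu]_p[EFin \o g])%E.
Proof.
move=> mf mg fg; rewrite unlock /Lnorm; case: p p1 => [r| |] //= _.
- congr (_ `^ _)%E; apply: ge0_ae_eq_integral => //.
  + apply/measurable_EFinP; apply: (measurableT_comp (measurable_powR _)) => //.
    exact: measurableT_comp.
  + apply/measurable_EFinP; apply: (measurableT_comp (measurable_powR _)) => //.
    exact: measurableT_comp.
  + by rewrite /ae_eq; apply: filterS fg => x /= fgx _; rewrite fgx.
- case: ifPn => // _; apply: eq_ess_sup.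
  by apply: filterS fg => x /= ->.
Qed.

Lemma Lfun_ae_eq f g : f = g %[ae mu] -> measurable_fun setT g ->
  f \in Lfun mu p -> g \in Lfun mu p.
Proof.
move=> fg mg; rewrite !LfunE => /asboolP[mf ff]; apply/asboolP; split => //.
by rewrite /finite_norm -(ae_eq_Lnorm mf).
Qed.

Definition mfun_of f (mf : measurable_fun setT f) : {mfun T >-> measurableTypeR R} :=
  HB.pack f (@isMeasurableFun.Build _ _ T (measurableTypeR R) f mf).

Definition ae_class f (mf : measurable_fun setT f) :
    {mfun_ mu, T >-> measurableTypeR R} :=
  (\pi_({mfun_ mu, T >-> measurableTypeR R}) (mfun_of mf))%qT.

Lemma ae_classE f (mf : measurable_fun setT f) :
  (ae_class mf : T -> R) = f %[ae mu].
Proof.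
have /eqmodP/asboolP :
  (\pi_({mfun_ mu, T >-> measurableTypeR R})
     (repr (\pi_({mfun_ mu, T >-> measurableTypeR R}) (mfun_of mf))) =
   \pi_({mfun_ mu, T >-> measurableTypeR R}) (mfun_of mf))%qT by rewrite reprK.
by [].
Qed.

Lemma LspaceP u : (u : T -> R) \in Lfun mu p.
Proof.
rewrite LfunE; apply/asboolP; split; last exact: Lebesgue_finite.
by rewrite /aqEqMfun_to_fun; move: (repr _) => g; exact: (measurable_funPT (g : {mfun T >-> measurableTypeR R})).
Qed.

Lemma Lspace_eqP u v : u = v <-> (u : T -> R) = v %[ae mu].
Proof.
split=> [->|]; first exact: aeW.
case: u v => [u [[pu]]] [v [[pv]]] /= uv.
have e : u = v.
  rewrite -(reprK u) -(reprK v); apply/eqmodP; exact/asboolP.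
by case: _ / e pv {uv} => pv; rewrite (Prop_irrelevance pu pv).
Qed.

Fact Lspace_of_subproof f (fL : f \in Lfun mu p) :
  finite_norm mu p (ae_class (set_mem (sub_Lfun_mfun fL))).
Proof.
set g := ae_class _; have gf : f = g %[ae mu].
  by apply: ae_eq_sym; exact: ae_classE.
have /asboolP[mf ff] : `[< measurable_fun setT f /\ finite_norm mu p f >].
  by rewrite -LfunE.
suff mg : measurable_fun setT (g : T -> R).
  by rewrite /finite_norm -(ae_eq_Lnorm mf mg gf).
exact: (measurable_funPT (repr g : {mfun T >-> measurableTypeR R})).
Qed.

Definition Lspace_of f (fL : f \in Lfun mu p) : LspaceType mu p1 :=
  HB.pack (ae_class (set_mem (sub_Lfun_mfun fL)))
    (@isFinLebesgue.Build _ _ _ mu p p1 _ (Lspace_of_subproof fL)).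

Lemma Lspace_ofE f (fL : f \in Lfun mu p) :
  (Lspace_of fL : T -> R) = f %[ae mu].
Proof. exact: ae_classE. Qed.

End Lspace_of.

Section Lspace_lmodType.
Context d (T : measurableType d) (R : realType).
Variables (mu : {measure set T -> \bar R}) (p : \bar R) (p1 : (1 <= p)%E).
Notation L := (LspaceType mu p1).
Implicit Types (u v w : L) (a b : R).

Fact Lfun0 : (0 : T -> R) \in Lfun mu p.
Proof. exact: (Lfun_submod_closed mu p1).1. Qed.

Fact LfunZD a (f g : T -> R) : f \in Lfun mu p -> g \in Lfun mu p ->
  (a *: f + g) \in Lfun mu p.
Proof. exact: (Lfun_submod_closed mu p1).2. Qed.

Fact LfunD (f g : T -> R) : f \in Lfun mu p -> g \in Lfun mu p ->
  (f + g) \in Lfun mu p.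
Proof. by move=> fL gL; rewrite -[f]scale1r; exact: LfunZD. Qed.

Fact LfunZ a (f : T -> R) : f \in Lfun mu p -> (a *: f) \in Lfun mu p.
Proof. by move=> fL; rewrite -[_ *: _]addr0; apply: LfunZD => //; exact: Lfun0. Qed.

Definition Lspace_zero : L := Lspace_of p1 Lfun0.
Definition Lspace_add u v : L := Lspace_of p1 (LfunD (LspaceP u) (LspaceP v)).
Definition Lspace_scale a u : L := Lspace_of p1 (LfunZ a (LspaceP u)).
Definition Lspace_opp u : L := Lspace_scale (- 1) u.

Let add_ae u v : (Lspace_add u v : T -> R) = (u : T -> R) + v %[ae mu].
Proof. exact: Lspace_ofE. Qed.
Let scale_ae a u : (Lspace_scale a u : T -> R) = a *: (u : T -> R) %[ae mu].
Proof. exact: Lspace_ofE. Qed.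
Let zero_ae : (Lspace_zero : T -> R) = (0 : T -> R) %[ae mu].
Proof. exact: Lspace_ofE. Qed.

Fact Lspace_addA : associative Lspace_add.
Proof.
move=> u v w; apply/Lspace_eqP.
apply: filterS2 (filterI (add_ae u (Lspace_add v w)) (add_ae v w))
  (filterI (add_ae (Lspace_add u v) w) (add_ae u v)) => x.
move=> -[/(_ I) + /(_ I) vw] [/(_ I) + /(_ I) uv] _ => -> ->.
by rewrite !fctE uv vw !fctE addrA.
Qed.

Fact Lspace_addC : commutative Lspace_add.
Proof.
move=> u v; apply/Lspace_eqP; apply: filterS2 (add_ae u v) (add_ae v u).
by move=> x + + _ => /(_ I) -> /(_ I) ->; rewrite !fctE addrC.
Qed.

Fact Lspace_add0 : left_id Lspace_zero Lspace_add.
Proof.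
move=> u; apply/Lspace_eqP; apply: filterS2 (add_ae Lspace_zero u) zero_ae.
by move=> x /(_ I) + /(_ I) z0 _ => ->; rewrite !fctE z0 add0r.
Qed.

Fact Lspace_addN : left_inverse Lspace_zero Lspace_opp Lspace_add.
Proof.
move=> u; apply/Lspace_eqP.
apply: filterS3 (add_ae (Lspace_opp u) u) zero_ae (scale_ae (- 1) u).
move=> x /(_ I) + /(_ I) + /(_ I) nu _ => -> ->.
by rewrite !fctE nu !fctE scaleN1r addNr.
Qed.

HB.instance Definition _ := gen_eqMixin L.
HB.instance Definition _ := gen_choiceMixin L.
HB.instance Definition _ := GRing.isZmodule.Build L
  Lspace_addA Lspace_addC Lspace_add0 Lspace_addN.

Fact Lspace_scaleA a b u :
  Lspace_scale a (Lspace_scale b u) = Lspace_scale (a * b) u.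
Proof.
apply/Lspace_eqP; apply: filterS3 (scale_ae a (Lspace_scale b u))
  (scale_ae b u) (scale_ae (a * b) u).
by move=> x /(_ I) + /(_ I) bu /(_ I) + _ => -> ->; rewrite !fctE bu !fctE scalerA.
Qed.

Fact Lspace_scale1 : left_id 1 Lspace_scale.
Proof.
move=> u; apply/Lspace_eqP; apply: filterS (scale_ae 1 u).
by move=> x /(_ I) + _ => ->; rewrite !fctE scale1r.
Qed.

Fact Lspace_scaleDr : right_distributive Lspace_scale +%R.
Proof.
move=> a u v; apply/Lspace_eqP.
apply: filterS3 (filterI (scale_ae a (u + v)) (add_ae u v))
  (add_ae (Lspace_scale a u) (Lspace_scale a v))
  (filterI (scale_ae a u) (scale_ae a v)).
move=> x [/(_ I) + /(_ I) uv] /(_ I) + [/(_ I) au /(_ I) av] _ => -> ->.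
by rewrite !fctE uv au av !fctE scalerDr.
Qed.

Fact Lspace_scaleDl u : {morph Lspace_scale^~ u : a b / a + b}.
Proof.
move=> a b; apply/Lspace_eqP.
apply: filterS3 (scale_ae (a + b) u)
  (add_ae (Lspace_scale a u) (Lspace_scale b u))
  (filterI (scale_ae a u) (scale_ae b u)).
move=> x /(_ I) + /(_ I) + [/(_ I) au /(_ I) bu] _ => -> ->.
by rewrite !fctE au bu !fctE scalerDl.
Qed.

HB.instance Definition _ := GRing.Zmodule_isLmodule.Build R L
  Lspace_scaleA Lspace_scale1 Lspace_scaleDr Lspace_scaleDl.

Lemma Lspace_addE u v : (u + v : L) = (u : T -> R) + v %[ae mu].
Proof. exact: add_ae. Qed.

Lemma Lspace_scaleE a u : (a *: u : L) = a *: (u : T -> R) %[ae mu].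
Proof. exact: scale_ae. Qed.

Lemma Lspace_zeroE : (0 : L) = (0 : T -> R) %[ae mu].
Proof. exact: zero_ae. Qed.

End Lspace_lmodType.

Section L2.
Context d (T : measurableType d) (R : realType).
Variable mu : {measure set T -> \bar R}.
Implicit Types (f g : T -> R).

Lemma Lfun2E f : (f \in Lfun mu 2%:E) =
  `[< measurable_fun setT f /\ (\int[mu]_x (`|f x| ^+ 2)%:E < +oo)%E >].
Proof.
rewrite LfunE; apply: asbool_equiv_eq.
have E : (\int[mu]_x (`|f x| ^+ 2)%:E = \int[mu]_x (`|(EFin \o f) x| `^ 2))%E.
  by apply: eq_integral => x _ /=; rewrite powR_mulrn.
rewrite E /finite_norm -poweR_Lnorm//.
split=> -[mf ff]; split => //; first exact: poweR_lty.
by apply: lty_poweRy ff.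
Qed.

Lemma Lfun2_le f g : measurable_fun setT f -> (forall x, `|f x| <= `|g x|) ->
  g \in Lfun mu 2%:E -> f \in Lfun mu 2%:E.
Proof.
move=> mf fg; rewrite !Lfun2E => /asboolP[mg gf]; apply/asboolP; split => //.
apply: le_lt_trans gf; apply: ge0_le_integral => //.
- by apply/measurable_EFinP; apply: measurable_funX; exact: measurableT_comp.
- by apply/measurable_EFinP; apply: measurable_funX; exact: measurableT_comp.
- by move=> x _; rewrite lee_fin lerXn2r ?nnegrE.
Qed.

Definition L2dot (u v : LspaceType2 mu) : R := \int[mu]_x (u x * v x).

Definition L2norm (u : LspaceType2 mu) : R := Num.sqrt (L2dot u u).

Fact L2min_subproof (u : LspaceType2 mu) (a : {nonneg R}) :
  (fun x => Num.min (u x) a%:num) \in Lfun mu 2%:E.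
Proof.
have := LspaceP u; apply: Lfun2_le.
  apply: measurable_minr; last exact: measurable_cst.
  by have := LspaceP u; rewrite Lfun2E => /asboolP[].
move=> x; case: (leP (u x) a%:num) => // au.
by rewrite !ger0_norm// ltW// (le_lt_trans _ au).
Qed.

Definition L2min (u : LspaceType2 mu) (a : {nonneg R}) : LspaceType2 mu :=
  Lspace_of _ (L2min_subproof u a).

Lemma L2minE (u : LspaceType2 mu) (a : {nonneg R}) :
  (L2min u a : T -> R) = (fun x => Num.min (u x) a%:num) %[ae mu].
Proof. exact: Lspace_ofE. Qed.

End L2.

Section image_measure.
Context d d' (T : measurableType d) (T' : measurableType d') (R : realType).
Variables (mu : {measure set T -> \bar R}) (phi : {mfun T >-> T'}).

Definition image_measure : set T' -> \bar R := pushforward mu phi.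

Let image_measure0 : image_measure set0 = 0%E.
Proof. exact: measure0. Qed.

Let image_measure_ge0 A : (0 <= image_measure A)%E.
Proof. exact: measure_ge0. Qed.

Let image_measure_sigma_additive : semi_sigma_additive image_measure.
Proof. exact: measure_semi_sigma_additive. Qed.

HB.instance Definition _ := isMeasure.Build _ _ _ image_measure
  image_measure0 image_measure_ge0 image_measure_sigma_additive.

Fact L2comp_subproof (f : LspaceType2 image_measure) :
  (f : T' -> R) \o phi \in Lfun mu 2%:E.
Proof.
have := LspaceP f; rewrite !Lfun2E => /asboolP[mf ff]; apply/asboolP; split.
  exact: measurableT_comp.
move: ff; rewrite ge0_integral_pushforward ?preimage_setT//.
by apply/measurable_EFinP; apply: measurable_funX; exact: measurableT_comp.
Qed.

(* Precomposition with phi maps null sets correctly, because f is a class modulo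
   the image measure. *)
Definition L2comp (f : LspaceType2 image_measure) : LspaceType2 mu :=
  Lspace_of _ (L2comp_subproof f).

Lemma L2compE (f : LspaceType2 image_measure) :
  (L2comp f : T -> R) = (f : T' -> R) \o phi %[ae mu].
Proof. exact: Lspace_ofE. Qed.

End image_measure.

Section forms.
Context d (T : measurableType d) (R : realType).
Variable mu : {measure set T -> \bar R}.
Notation L2 := (LspaceType2 mu).
Implicit Types (H : set L2) (E B : L2 -> L2 -> R) (a : R).

(* A form with domain H is a total function on L2 x L2; every condition below
   only constrains its values on H x H. *)

Definition linear_domain H :=
  H 0 /\ forall a u v, H u -> H v -> H (a *: u + v).

Definition L2dense H :=
  forall (f : L2) e, 0 < e -> exists2 g, H g & L2norm (f - g) < e.

Definition bilinear_on H B :=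
  (forall a u v w, H u -> H v -> H w ->
     B (a *: u + v) w = a * B u w + B v w) /\
  (forall a u v w, H u -> H v -> H w ->
     B w (a *: u + v) = a * B w u + B w v).

Definition antisymmetric_on H B :=
  forall u v, H u -> H v -> B u v = - B v u.

Definition sym_part E (u v : L2) := (E u v + E v u) / 2.

Definition form_shift a E (u v : L2) := E u v + a * L2dot u v.

Definition inner_product_on H B :=
  [/\ bilinear_on H B,
      forall u v, H u -> H v -> B u v = B v u,
      forall u, H u -> 0 <= B u u &
      forall u, H u -> B u u = 0 -> u = 0].

Definition complete_on H B :=
  forall u : nat -> L2, (forall n, H (u n)) ->
    (forall e, 0 < e -> exists N, forall i j, (N <= i)%N -> (N <= j)%N ->
       Num.sqrt (B (u i - u j) (u i - u j)) < e) ->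
    exists2 v, H v & Num.sqrt (B (u n - v) (u n - v)) @[n --> \oo] --> (0 : R).

Definition hilbert_on H B := inner_product_on H B /\ complete_on H B.

Record bilinear_closed_form H E a0 : Prop := {
  bcf_domain : linear_domain H ;
  bcf_dense : L2dense H ;
  bcf_bilinear : bilinear_on H E ;
  bcf_lower_bound : forall u, H u -> 0 <= form_shift a0 (sym_part E) u u ;
  bcf_hilbert : hilbert_on H (form_shift (a0 + 1) (sym_part E)) ;
  bcf_sector : exists2 K : R, 1 <= K & forall u v, H u -> H v ->
    `|form_shift (a0 + 1) E u v| <=
      K * Num.sqrt (form_shift (a0 + 1) E u u)
        * Num.sqrt (form_shift (a0 + 1) E v v) }.

Record dirichlet_form H E a0 : Prop := {
  df_closed : bilinear_closed_form H E a0 ;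
  df_contraction : forall u (a : {nonneg R}), H u ->
    H (L2min u a) /\ 0 <= E (L2min u a) (u - L2min u a) }.

End forms.

Section mosco.
Context d d' (T : measurableType d) (T' : measurableType d') (R : realType).
Variables (mu : {measure set T -> \bar R}) (nu : {measure set T' -> \bar R}).
Notation L2T := (LspaceType2 mu).
Notation L2T' := (LspaceType2 nu).
Variable Phi : nat -> L2T' -> L2T.

Definition hilbert_cvg :=
  (forall n, linear (Phi n)) /\
  (forall f, L2norm (Phi n f) @[n --> \oo] --> L2norm f).

Definition strong_cvg (u : nat -> L2T) (ut : L2T') :=
  L2norm (Phi n ut - u n) @[n --> \oo] --> (0 : R).

Definition weak_cvg (u : nat -> L2T) (ut : L2T') :=
  forall (v : nat -> L2T) (vt : L2T'), strong_cvg v vt ->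
    L2dot (u n) (v n) @[n --> \oo] --> L2dot ut vt.

Variables (a0 : R) (H : nat -> set L2T) (E : nat -> L2T -> L2T -> R).
Variables (Ht : set L2T') (Et : L2T' -> L2T' -> R).

(* The supremum is taken in the extended reals, and it is -oo when H n = 0. *)
Definition mosco_Theta n (u : L2T) : \bar R :=
  ereal_sup [set (form_shift (a0 + 1) (E n) v u)%:E
            | v in [set v | H n v /\ form_shift (a0 + 1) (E n) v v = 1]].

Definition mosco_F1 :=
  forall (u : nat -> L2T) (ut : L2T'), (forall n, H n (u n)) ->
    weak_cvg u ut -> (limn_einf (fun n => mosco_Theta n (u n)) < +oo)%E ->
    Ht ut.

Definition mosco_F2 :=
  forall (u : nat -> L2T) (ut : L2T'), (forall n, H n (u n)) ->
    weak_cvg u ut -> Ht ut ->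
    forall vt, Ht vt ->
    exists v : nat -> L2T, [/\ forall n, H n (v n), strong_cvg v vt &
      E n (v n) (u n) @[n --> \oo] --> Et vt ut].

Definition mosco_cvg := [/\ hilbert_cvg, mosco_F1 & mosco_F2].

End mosco.

Section averaging.
Context d d' (T : measurableType d) (T' : measurableType d') (R : realType).
Variables (mu : {measure set T -> \bar R}) (phi : {mfun T >-> T'}).
Notation L2T := (LspaceType2 mu).
Notation L2T' := (LspaceType2 (image_measure mu phi)).

Definition perturbed_form (E Ea : L2T -> L2T -> R) (k : R) (u v : L2T) :=
  E u v + k * Ea u v.

Definition image_domain (H : set L2T) : set L2T' := [set f | H (L2comp f)].

Definition image_form (E : L2T -> L2T -> R) (f g : L2T') :=
  E (L2comp f) (L2comp g).

End averaging.

(* A measurableType carries a distinguished point, so a metric space must be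
   pointed (that is, nonempty) in order to bear a Borel sigma-algebra. *)
#[short(type="pmetricType")]
HB.structure Definition PointedMetric (K : numDomainType) :=
  {M of PseudoPointedMetric K M & PseudoMetric_isMetric K M}.

Notation borel M := (g_sigma_algebraType (@open M)).

Section metric_measure.
Context (R : realType) (M : pmetricType R).
Implicit Type m : {measure set (borel M) -> \bar R}.

Definition separable_space := exists2 D : set M, countable D & dense D.

(* On a locally compact separable metric space the second condition follows from
   the first. *)
Definition radon_measure m :=
  (forall K : set M, compact K -> (m K < +oo)%E) /\
  (forall A : set M, measurable (A : set (borel M)) ->
     m A = ereal_sup [set m K | K in [set K : set M | compact K /\ K `<=` A]]).

Definition measure_supp m : set M :=
  [set x | forall U : set M, open_nbhs x U -> (0 < m U)%E].

End metric_measure.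

(* Main.v *)
(* Since E^a(u, u) = 0, the energy of E^kappa does not depend on kappa. If (u_n)
   is bounded in energy and kappa_n E^a(v, u_n) is bounded for every v, then every
   weak cluster point of (u_n) in H lies in the kernel of E^a, that is, it
   factors through pi; this is (F1).
   For (F2), let v = g o pi lie in H and let x_(k,n) be the Lax-Milgram solution of
     E^(kappa_n)_(a0+1)(x, .) + k <x, .> = k <v, .>   on H.
   As n -> oo, x_(k,n) converges in energy to some z_k in the kernel of E^a, and
   z_k -> v in energy as k -> oo. The equation expresses E^(kappa_n)(x_(k,n), u_n)
   by L2 products, so that the weak convergence of u_n gives its limit without any
   energy bound on u_n; a diagonal choice k = s(n) concludes. *)

Require Import Defs.
From HB Require Import structures.
From mathcomp Require Import all_boot all_order all_algebra.
From mathcomp Require Import all_classical all_reals all_analysis.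
From mathcomp Require Import measurable_realfun ring lra.

Import Order.TTheory GRing.Theory Num.Theory.
Import numFieldNormedType.Exports.

Set Implicit Arguments.
Unset Strict Implicit.
Unset Printing Implicit Defensive.

Local Open Scope classical_set_scope.
Local Open Scope ring_scope.

(** * Minimization in Hilbert spaces *)

Section scalar_theory.
Context (R : realType) (V : lmodType R) (l : V -> R).
Hypothesis ll : scalar l.

Lemma scalf0 : l 0 = 0.
Proof. by have := ll (-1) 0 0; rewrite scaler0 addr0 mulN1r addNr. Qed.

Lemma scalfD u v : l (u + v) = l u + l v.
Proof. by have := ll 1 u v; rewrite scale1r mul1r. Qed.

Lemma scalfZ a u : l (a *: u) = a * l u.
Proof. by have := ll a u 0; rewrite scalf0 !addr0. Qed.

Lemma scalfN u : l (- u) = - l u.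
Proof. by rewrite -scaleN1r scalfZ mulN1r. Qed.

Lemma scalfB u v : l (u - v) = l u - l v.
Proof. by rewrite scalfD scalfN. Qed.

End scalar_theory.

(** * Semi-inner products, bounded bilinear forms and bounded functionals *)

Section semi_inner_product.
Context (R : realType) (V : lmodType R).
Implicit Types (B F : V -> V -> R).

Definition bilin F := (forall u, scalar (F u)) /\ (forall u, scalar (F^~ u)).

(** Squared to avoid square roots, so [K] is the square of the usual constant; [dual] follows the
    same convention. *)
Definition bounded_by B F := exists2 K, 0 <= K &
  forall u v, F u v ^+ 2 <= K * B u u * B v v.

Record semi_inner B : Prop := {
  si_bilin : bilin B;
  si_sym : forall u v, B u v = B v u;
  si_ge0 : forall u, 0 <= B u u }.

Definition dual B (l : V -> R) := scalar l /\
  exists2 K, 0 <= K & forall u, l u ^+ 2 <= K * B u u.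

Variable B : V -> V -> R.
Hypothesis hB : semi_inner B.
Let Bl u := (si_bilin hB).1 u.

Lemma semi_innerD u v : B (u + v) (u + v) = B u u + 2 * B u v + B v v.
Proof.
rewrite (scalfD (Bl _)) !(si_sym hB (u + v)) !(scalfD (Bl _)).
by rewrite (si_sym hB v u); ring.
Qed.

Lemma semi_innerZ a u : B (a *: u) (a *: u) = a ^+ 2 * B u u.
Proof.
by rewrite (scalfZ (Bl _)) (si_sym hB) (scalfZ (Bl _)); ring.
Qed.

Lemma semi_innerN u : B (- u) (- u) = B u u.
Proof. by rewrite -scaleN1r semi_innerZ sqrrN expr1n mul1r. Qed.

Lemma semi_innerB u v : B (u - v) (u - v) = B u u - 2 * B u v + B v v.
Proof. by rewrite semi_innerD semi_innerN (scalfN (Bl _)); ring. Qed.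

Lemma semi_innerBC u v : B (u - v) (u - v) = B (v - u) (v - u).
Proof. by rewrite -semi_innerN opprB. Qed.

Lemma semi_inner_mid u v : B (2^-1 *: (u + v)) (2^-1 *: (u + v)) =
  (2 * B u u + 2 * B v v - B (u - v) (u - v)) / 4.
Proof. by rewrite semi_innerZ semi_innerD semi_innerB; field. Qed.

Lemma semi_innerD_le u v : B (u + v) (u + v) <= 2 * B u u + 2 * B v v.
Proof.
by have := si_ge0 hB (u - v); rewrite semi_innerB semi_innerD; lra.
Qed.

(** The polynomial [B (t *: u + v) (t *: u + v)] in [t] is nonnegative; evaluate it at its minimum,
    or use its affine form if [B u u = 0]. *)
Lemma cauchy_schwarz u v : B u v ^+ 2 <= B u u * B v v.
Proof.
have a0 := si_ge0 hB u; have c0 := si_ge0 hB v.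
have q t : 0 <= B u u * t ^+ 2 + 2 * t * B u v + B v v.
  have := si_ge0 hB (t *: u + v).
  rewrite semi_innerD semi_innerZ (si_sym hB (t *: u)) (scalfZ (Bl _)).
  by rewrite (si_sym hB v u); lra.
have [au|au] := ltP 0 (B u u).
  have := q (- (B u v / B u u)); rewrite -(pmulr_rge0 _ au).
  have -> : B u u * (B u u * (- (B u v / B u u)) ^+ 2 +
     2 * - (B u v / B u u) * B u v + B v v) = B u u * B v v - B u v ^+ 2.
    by field; rewrite gt_eqF.
  by rewrite subr_ge0.
have {au}au : B u u = 0 by apply/eqP; rewrite eq_le au.
have [->|b0] := eqVneq (B u v) 0; first by rewrite expr0n /= au mul0r.
(* The polynomial is now affine with nonzero slope, and this [t] gives it the value -1. *)
have := q (- (B v v + 1) / (2 * B u v)).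
have -> : B u u * (- (B v v + 1) / (2 * B u v)) ^+ 2 +
    2 * (- (B v v + 1) / (2 * B u v)) * B u v + B v v = -1.
  by rewrite au; field.
by lra.
Qed.

Lemma bounded_by_self : bounded_by B B.
Proof. by exists 1 => // u v; rewrite mul1r; exact: cauchy_schwarz. Qed.

Lemma bilin_dualr F : bilin F -> bounded_by B F -> forall u, dual B (F u).
Proof.
move=> bF [K K0 hK] u; split; first exact: bF.1.
by exists (K * B u u); rewrite ?mulr_ge0// ?(si_ge0 hB).
Qed.

Lemma bilin_duall F : bilin F -> bounded_by B F -> forall u, dual B (F^~ u).
Proof.
move=> bF [K K0 hK] u; split; first exact: bF.2.
exists (K * B u u); rewrite ?mulr_ge0// ?(si_ge0 hB)// => v.
by rewrite mulrAC.
Qed.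

Lemma dualN l : dual B l -> dual B (fun u => - l u).
Proof.
move=> [ll [K K0 hK]]; split; last by exists K => // u; rewrite sqrrN.
by move=> a u v; rewrite ll; ring.
Qed.

Lemma dualZ c l : dual B l -> dual B (fun u => c * l u).
Proof.
move=> [ll [K K0 hK]]; split; first by move=> a u v; rewrite ll; ring.
exists (c ^+ 2 * K) => [|u]; first by rewrite mulr_ge0// sqr_ge0.
by rewrite exprMn -(mulrA _ K); apply: (ler_wpM2l (sqr_ge0 c)); exact: hK.
Qed.

Lemma dualD l1 l2 : dual B l1 -> dual B l2 -> dual B (fun u => l1 u + l2 u).
Proof.
move=> [ll1 [K1 K10 hK1]] [ll2 [K2 K20 hK2]]; split.
  by move=> a u v; rewrite ll1 ll2; ring.
exists (2 * K1 + 2 * K2) => [|u]; first lra.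
have := hK1 u; have := hK2 u; have := sqr_ge0 (l1 u - l2 u).
rewrite sqrrB sqrrD; lra.
Qed.

Lemma dual_cvg l (w : nat -> V) z : dual B l ->
  B (w n - z) (w n - z) @[n --> \oo] --> (0 : R) -> l (w n) @[n --> \oo] --> l z.
Proof.
move=> [ll [K K0 hK]] wz; apply/cvgrPdist_lt => e e0.
(* [K + 1] replaces [K], which may vanish. *)
have e2 : 0 < e ^+ 2 / (K + 1) by rewrite divr_gt0 ?exprn_gt0// ltr_wpDl.
move/cvgrPdist_lt : wz => /(_ _ e2); apply: filterS => n.
rewrite sub0r normrN ger0_norm ?(si_ge0 hB)// => h.
rewrite distrC -(scalfB ll).
suff : `|l (w n - z)| ^+ 2 < e ^+ 2 by rewrite ltr_pXn2r ?nnegrE ?normr_ge0 ?ltW.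
rewrite real_normK ?num_real//.
apply: le_lt_trans (hK _) _.
apply: (@le_lt_trans _ _ ((K + 1) * B (w n - z) (w n - z))).
  by rewrite ler_wpM2r ?(si_ge0 hB)// lerDl.
by rewrite mulrC -ltr_pdivlMr// ltr_wpDl.
Qed.

End semi_inner_product.

(** * Minimizing sequences, Riesz representation and weak cluster points *)

Section hilbert.
Context (R : realType) (V : lmodType R).

Record hilbert_inner (B : V -> V -> R) : Prop := {
  hi_semi :> semi_inner B;
  hi_def : forall u, B u u = 0 -> u = 0;
  hi_complete : forall u : nat -> V,
    (forall e, 0 < e -> exists N, forall i j, (N <= i)%N -> (N <= j)%N ->
       B (u i - u j) (u i - u j) < e) ->
    exists v, B (u n - v) (u n - v) @[n --> \oo] --> (0 : R) }.

(** Midpoints are all that the parallelogram identity requires. *)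
Definition midconvex (C : set V) :=
  forall x y, C x -> C y -> C (2^-1 *: (x + y)).

Variable B : V -> V -> R.
Hypothesis hB : hilbert_inner B.
Let B0 u : 0 <= B u u := si_ge0 hB u.

(** The infima [d n] increase, since the sets shrink, and stay below [M], hence converge; the
    parallelogram identity then makes near-minimizers a Cauchy sequence. *)
Lemma midconvex_minimizing (C : nat -> set V) (M : R) :
  (forall n, midconvex (C n)) -> (forall i j, (i <= j)%N -> C j `<=` C i) ->
  (forall n, exists2 x, C n x & B x x <= M) ->
  exists (w : nat -> V) z, [/\ forall n, C n (w n),
    forall n x, C n x -> B (w n) (w n) <= B x x + n.+1%:R^-1 &
    B (w n - z) (w n - z) @[n --> \oo] --> (0 : R)].
Proof.
move=> Cmid Cdec CM.
pose S n := [set B x x | x in C n].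
have Sinf n : has_inf (S n).
  by split; [have [x Cx _] := CM n; exists (B x x), x | exists 0 => _ [x _ <-]].
pose d n := inf (S n).
have dle n x : C n x -> d n <= B x x.
  by move=> Cx; apply: ge_inf; [exact: (Sinf n).2|exists x].
have dM n : d n <= M by have [x Cx] := CM n; apply: le_trans; exact: dle.
have /choice[w hw] : forall n, exists x, C n x /\ B x x < d n + n.+1%:R^-1.
  move=> n; have [|_ [x Cx <-] h] := @inf_adherent _ (S n) n.+1%:R^-1 _ (Sinf n).
    by rewrite invr_gt0 ltr0n.
  by exists x.
have dsup : has_sup (range d).
  by split; [exists (d 0%N), 0%N | exists M => _ [n _ <-]].
have Cauchy (e : R) : 0 < e -> exists N, forall i j, (N <= i)%N -> (N <= j)%N ->
    B (w i - w j) (w i - w j) < e.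
  move=> e0; have e8 : 0 < e / 8 by rewrite divr_gt0.
  (* Beyond [N1] and [N2] every [w k] has energy below [d N1 + e / 4], while midpoints lie in [C N1]
     and have energy at least [d N1]. The parallelogram identity leaves less than [4 * (e / 4)] for
     the difference. *)
  have [_ [N1 _ <-] hN1] := sup_adherent e8 dsup.
  have [N2 hN2] : exists N, N.+1%:R^-1 < e / 8.
    exists (Num.truncn (e / 8)^-1); rewrite invf_plt ?posrE// ?ltr0n//.
    exact: truncnS_gt.
  exists (maxn N1 N2) => i j.
  rewrite !geq_max => /andP[iN1 iN2] /andP[jN1 jN2].
  have bound k : (N1 <= k)%N -> (N2 <= k)%N -> B (w k) (w k) < d N1 + e / 4.
    move=> k1 k2; have [_ /lt_le_trans] := hw k; apply.
    have : d k <= sup (range d) by apply: ub_le_sup; [exact: dsup.2|exists k].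
    have : k.+1%:R^-1 <= N2.+1%:R^-1 :> R by rewrite lef_pV2 ?posrE ?ltr0n// ler_nat.
    by move: (sup _) (d k) (d N1) k.+1%:R^-1 N2.+1%:R^-1 hN1 hN2 => a b c p q; lra.
  have : d N1 <= B (2^-1 *: (w i + w j)) (2^-1 *: (w i + w j)).
    by apply: dle; apply: Cmid; [exact: Cdec (hw i).1|exact: Cdec (hw j).1].
  rewrite (semi_inner_mid hB); move: (bound i iN1 iN2) (bound j jN1 jN2).
  lra.
have [z wz] := hi_complete hB Cauchy.
exists w, z; split=> // [n|n x Cx]; first exact: (hw n).1.
by apply/ltW/(lt_le_trans (hw n).2); rewrite lerD2r; exact: dle.
Qed.

(** The point [z] of least norm on the hyperplane [l = 1] is orthogonal to the kernel of [l], so a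
    multiple of [z] represents [l]. *)
Lemma riesz l : dual B l -> exists g, forall u, l u = B g u.
Proof.
move=> lB; have ll := lB.1.
have [[x lx]|nl] := pselect (exists x, l x != 0); last first.
  exists 0 => u; rewrite (scalf0 ((si_bilin hB).2 u)).
  by apply/eqP; apply/negP => /negP lu; apply: nl; exists u.
pose x1 := (l x)^-1 *: x.
have lx1 : l x1 = 1 by rewrite (scalfZ ll) mulVf.
have [|||w [z [wC wmin wz]]] := @midconvex_minimizing (fun=> [set u | l u = 1]) (B x1 x1).
- move=> _ u v /= lu lv; rewrite (scalfZ ll) (scalfD ll) lu lv.
  by rewrite -mulr2n mulVf. 
- by move=> i j ij; exact: subset_refl.
- by move=> _; exists x1.
have lz : l z = 1.
  have := dual_cvg hB lB wz.
  under eq_cvg do rewrite wC.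
  by move/(cvg_lim (@Rhausdorff R)); rewrite lim_cst//; exact: Rhausdorff.
have Bz h : l h = 0 -> B z h = 0.
  move=> lh.
  (* Moving [w n] by [t *: h] stays in the hyperplane; near-minimality of [w n] passes to the limit
     [z]. *)
  have ineq t : 0 <= 2 * t * B z h + t ^+ 2 * B h h.
    have cv : (2 * t * B (w n) h + t ^+ 2 * B h h + n.+1%:R^-1) @[n --> \oo] -->
        2 * t * B z h + t ^+ 2 * B h h + 0.
      apply: cvgD; last exact: cvg_harmonic.
      apply: cvgD; last exact: cvg_cst.
      apply: (cvgM (cvg_cst _)); apply: (dual_cvg hB (l := B^~ h)) => //.
      exact: (bilin_duall hB (si_bilin hB) (bounded_by_self hB)).
    rewrite -[leRHS]addr0; apply: (cvgr_to_ge cv); apply: nearW => n.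
    have /(wmin n) : l (w n + t *: h) = 1.
      by rewrite (scalfD ll) (scalfZ ll) lh wC mulr0 addr0.
    rewrite (semi_innerD hB) (semi_innerZ hB).
    rewrite (scalfZ ((si_bilin hB).1 _)); move: n.+1%:R^-1 => c; lra.
  have [h0|h0] := eqVneq (B h h) 0.
    by rewrite (hi_def hB h0) (scalf0 ((si_bilin hB).1 _)).
  (* The minimizer in [t] of the right-hand side. *)
  have := ineq (- B z h / B h h).
  have -> : 2 * (- B z h / B h h) * B z h + (- B z h / B h h) ^+ 2 * B h h =
     - (B z h ^+ 2 / B h h) by field.
  rewrite oppr_ge0 => h1; apply/eqP; rewrite -sqrf_eq0 eq_le sqr_ge0 andbT.
  by rewrite pmulr_lle0 ?invr_gt0 ?lt0r ?h0 ?B0// in h1.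
have zz : B z z != 0.
  apply/eqP => /(hi_def hB) z0; move: lz; rewrite z0 (scalf0 ll).
  by apply/eqP; rewrite eq_sym oner_eq0.
exists ((B z z)^-1 *: z) => u.
rewrite (scalfZ ((si_bilin hB).2 _)).
have := Bz (u - l u *: z).
rewrite (scalfB ll) (scalfZ ll) lz mulr1 subrr => /(_ erefl).
rewrite (scalfB ((si_bilin hB).1 _)) (scalfZ ((si_bilin hB).1 _)).
by move/eqP; rewrite subr_eq0 => /eqP ->; field.
Qed.

(* Vectors of nearly minimal norm in the midpoint-convex hulls of the tails
   converge strongly, which replaces weak sequential compactness. *)
Lemma bounded_half_space (x : nat -> V) (M : R) : (forall n, B (x n) (x n) <= M) ->
  exists z, forall l c, dual B l -> (\forall n \near \oo, l (x n) <= c) ->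
    l z <= c.
Proof.
move=> xM.
pose C n : set V := [set y | forall P : set V, midconvex P ->
  (forall k, (n <= k)%N -> P (x k)) -> P y].
have [|||w [z [wC _ wz]]] := @midconvex_minimizing C M.
- by move=> n u v Cu Cv P mP Px; apply: (mP) (Cu P mP Px) (Cv P mP Px).
- by move=> i j ij y Cy P mP Px; apply: Cy => // k /(leq_trans ij); exact: Px.
- by move=> n; exists (x n) => // P _; apply.
exists z => l c lB [N _ hN].
apply: (cvgr_to_le (dual_cvg hB lB wz)).
(* The half space is midpoint convex and contains the tail from [n] on, hence also [w n]. *)
exists N => // n /= Nn; apply: (wC n [set y | l y <= c]).
- by move=> u v /= lu lv; rewrite (scalfZ lB.1) (scalfD lB.1); lra.
- by move=> k /(leq_trans Nn); exact: hN.
Qed.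

(** If [l (x n)] tends to [c], the half spaces [l <= c + e] and [- l <= - (c - e)] eventually
    contain the sequence and force [l z = c]. *)
Lemma bounded_weak_cluster (x : nat -> V) (M : R) : (forall n, B (x n) (x n) <= M) ->
  exists z, (forall l c, dual B l -> (\forall n \near \oo, l (x n) <= c) ->
    l z <= c) /\ forall l c, dual B l -> l (x n) @[n --> \oo] --> c -> l z = c.
Proof.
move=> /bounded_half_space[z hz]; exists z; split=> // l c lB lc.
apply/eqP; rewrite eq_le; apply/andP; split; apply/ler_addgt0Pr => e e0.
- apply: hz => //; move/cvgrPdist_lt : lc => /(_ _ e0); apply: filterS => n.
  by rewrite ltr_norml => /andP[]; lra.
- rewrite -lerBlDr -lerN2; apply: (hz (fun u => - l u)); first exact: dualN.
  move/cvgrPdist_lt : lc => /(_ _ e0); apply: filterS => n.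
  by rewrite ltr_norml => /andP[]; lra.
Qed.

(** Otherwise a subsequence keeps [l] away from 0. A weak cluster point of it is annihilated by all
    of [L], hence by [l], which is a contradiction. *)
Lemma weak_vanish (L : set (V -> R)) l (x : nat -> V) (M : R) :
  (forall n, B (x n) (x n) <= M) -> dual B l -> L `<=` dual B ->
  (forall k, L k -> k (x n) @[n --> \oo] --> (0 : R)) ->
  (forall z, (forall k, L k -> k z = 0) -> l z = 0) ->
  l (x n) @[n --> \oo] --> (0 : R).
Proof.
move=> xM lB LB Lx lL; apply/cvgrPdist_lt => e e0; apply: contrapT => nl.
have /choice[s hs] : forall N, exists n, (N <= n)%N /\ e <= `|l (x n)|.
  move=> N; apply: contrapT => nN; apply: nl; exists N => // n /= Nn.
  by rewrite sub0r normrN ltNge; apply/negP => h; apply: nN; exists n.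
(* The signs make [l (y n) = |l (x (s n))| >= e], a one-sided bound that survives in the cluster
   point. *)
pose y n := Num.sg (l (x (s n))) *: x (s n).
have yM n : B (y n) (y n) <= M.
  apply: le_trans (xM (s n)); rewrite (semi_innerZ hB) -[leRHS]mul1r.
  by apply: ler_wpM2r => //; rewrite sqr_sg; case: (_ != 0).
have [z [zle zc]] := bounded_weak_cluster yM.
have : - l z <= - e.
  apply: (zle (fun u => - l u)); first exact: dualN.
  apply: nearW => n; rewrite (scalfZ lB.1) -normrEsg lerN2; exact: (hs n).2.
rewrite lL ?oppr0; first lra.
move=> k Lk; apply: zc; first exact: LB.
apply/cvgrPdist_lt => d d0; move/cvgrPdist_lt : (Lx k Lk) => /(_ _ d0)[N _ hN].
exists N => // n /= Nn; rewrite sub0r normrN (scalfZ (LB _ Lk).1) normrM.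
have := hN (s n) (leq_trans Nn (hs n).1); rewrite sub0r normrN.
apply: le_lt_trans; rewrite -[leRHS]mul1r ler_wpM2r//.
by rewrite normr_sg; case: (_ != 0).
Qed.

End hilbert.

(* Riesz' theorem is applied twice: to represent F by an operator A, and then to
   the inner product (v, w) |-> B (A v) (A w), whose representing vector solves
   the least squares problem for A v = g. *)
Lemma lax_milgram (R : realType) (V : lmodType R) (B F : V -> V -> R) (l : V -> R) :
  hilbert_inner B -> bilin F -> bounded_by B F ->
  (forall u, B u u <= F u u) -> dual B l -> exists v, forall u, F v u = l u.
Proof.
move=> hB bF FB coer lB; have B0 := si_ge0 hB.
have Bl u := (si_bilin hB).1 u; have Br u := (si_bilin hB).2 u.
have /choice[A hA] : forall v, exists g, forall u, F v u = B g u.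
  by move=> v; apply: (riesz hB); exact: (bilin_dualr hB).
have Alin a u v : A (a *: u + v) = a *: A u + A v.
  apply/eqP; rewrite -subr_eq0; apply/eqP; apply: (hi_def hB).
  set x := (X in B X X).
  by rewrite {1}/x (scalfB (Br _)) Br -!hA bF.2 subrr.
pose B' u v := B (A u) (A v).
have BB' u : B u u <= B' u u.
  have [->|u0] := eqVneq (B u u) 0; first exact: B0.
  have upos : 0 < B u u by rewrite lt0r u0 B0.
  rewrite -(ler_pM2r upos); apply: le_trans (cauchy_schwarz hB _ _).
  by rewrite -expr2 -hA lerXn2r ?nnegrE ?B0// (le_trans (B0 u)).
have [K K0 hK] := FB.
have B'B u : B' u u <= K * B u u.
  have [->|u0] := eqVneq (B' u u) 0; first by rewrite mulr_ge0.
  have upos : 0 < B' u u by rewrite lt0r u0 B0.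
  by rewrite -(ler_pM2r upos) -expr2 {1}/B' -hA; exact: hK.
(* Coercivity and boundedness of [F] make [B'] equivalent to [B], so completeness carries over. *)
have hB' : hilbert_inner B'.
  split.
  - split=> [|u v|u]; [|exact: (si_sym hB)|exact: B0].
    split=> u a x y; rewrite /B' Alin; [exact: Bl|exact: Br].
  - by move=> u u0; apply: (hi_def hB); apply/eqP; rewrite eq_le B0 -u0 BB'.
  - move=> u Cu; have [|v uv] := hi_complete hB (u := u).
      move=> e /Cu[N hN]; exists N => i j iN jN.
      exact: le_lt_trans (BB' _) (hN i j iN jN).
    exists v; apply: (@squeeze_cvgr _ _ _ _ (cst 0) (fun n => K * B (u n - v) (u n - v))).
    + by apply: nearW => n; rewrite B0 B'B.
    + exact: cvg_cst.
    + by rewrite -(mulr0 K); exact: (cvgM (cvg_cst _)).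
have [g hg] := riesz hB lB.
have [|v hv] := riesz hB' (l := fun u => B g (A u)).
  split; first by move=> a x y; rewrite Alin; exact: Bl.
  by exists (B g g) => // u; exact: (cauchy_schwarz hB).
exists v => u; rewrite hA hg; apply/eqP; rewrite -subr_eq0 -(scalfB (Br _)).
suff -> : A v - g = 0 by rewrite (scalf0 (Br _)).
(* The equation [hv] says that the residual [r] is orthogonal to the range of [A], so
   [B r r <= F r r = B (A r) r = 0]. *)
set r := A v - g; apply: (hi_def hB); apply/eqP; rewrite eq_le B0 andbT.
apply: le_trans (coer r) _; rewrite hA (si_sym hB) {1}/r (scalfB (Br _)) hv.
by rewrite /B' subrr.
Qed.


(** * Large antisymmetric perturbations *)

Section perturbation.
Context (R : realType) (V : lmodType R).
Implicit Types (B F G : V -> V -> R).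

Lemma bilinD F G : bilin F -> bilin G -> bilin (fun u v => F u v + G u v).
Proof.
by move=> [Fl Fr] [Gl Gr]; split=> u a x y; rewrite ?Fl ?Gl ?Fr ?Gr; ring.
Qed.

Lemma bilinZ c F : bilin F -> bilin (fun u v => c * F u v).
Proof. by move=> [Fl Fr]; split=> u a x y; rewrite ?Fl ?Fr; ring. Qed.

Lemma bounded_byD B F G : bounded_by B F -> bounded_by B G ->
  bounded_by B (fun u v => F u v + G u v).
Proof.
move=> [K1 K10 hK1] [K2 K20 hK2].
exists (2 * K1 + 2 * K2) => [|u v]; first lra.
have := hK1 u v; have := hK2 u v; have := sqr_ge0 (F u v - G u v).
rewrite sqrrB sqrrD; lra.
Qed.

Lemma bounded_byZ B c F : bounded_by B F -> bounded_by B (fun u v => c * F u v).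
Proof.
move=> [K K0 hK]; exists (c ^+ 2 * K) => [|u v].
  by rewrite mulr_ge0// sqr_ge0.
rewrite exprMn -[leRHS]mulrA -(mulrA _ K) (mulrA K).
by apply: (ler_wpM2l (sqr_ge0 c)); exact: hK.
Qed.

Lemma bounded_by_le B F : semi_inner F ->
  (forall u, F u u <= B u u) -> bounded_by B F.
Proof.
move=> hF FB; exists 1 => // u v; rewrite mul1r.
apply: le_trans (cauchy_schwarz hF u v) _.
by apply: ler_pM => //; exact: (si_ge0 hF).
Qed.

Lemma cvg0_mul_bounded (k a : nat -> R) (C : R) : k n @[n --> \oo] --> +oo ->
  (forall n, `|k n * a n| <= C) -> a n @[n --> \oo] --> (0 : R).
Proof.
move=> koo kaC; apply/cvgrPdist_lt => e e0.
have C0 : 0 <= C by apply: le_trans (kaC 0%N).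
move/cvgryPgt : koo => /(_ (C / e)); apply: filterS => n kn.
have k0 : 0 < k n by apply: le_lt_trans kn; rewrite divr_ge0// ltW.
rewrite sub0r normrN -(ltr_pM2l k0); apply: le_lt_trans (_ : _ <= C) _.
  by rewrite -{1}(gtr0_norm k0) -normrM.
by rewrite -ltr_pdivrMr.
Qed.

Lemma sqr_le_self (x c : R) : x ^+ 2 <= c * x -> 0 <= c -> x <= c.
Proof.
move=> h c0; have [x0|x0] := leP x 0; first exact: le_trans x0 c0.
by rewrite -(ler_pM2r x0) -expr2.
Qed.

Variables B dot G A : V -> V -> R.
Hypotheses (hB : hilbert_inner B) (hdot : semi_inner dot).
Hypothesis dot_def : forall u, dot u u = 0 -> u = 0.
Hypothesis dotB : forall u, dot u u <= B u u.
Hypotheses (bG : bilin G) (BG : bounded_by B G) (GB : forall u, G u u = B u u).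
Hypotheses (bA : bilin A) (BA : bounded_by B A).
Hypothesis A_anti : forall u v, A u v = - A v u.

Let A0 u : A u u = 0.
Proof. by have := A_anti u u; lra. Qed.

Let Bdot : bounded_by B dot.
Proof. exact: (bounded_by_le hdot dotB). Qed.

(** Since [A] vanishes on the diagonal, testing the equation with [x n] bounds its energy uniformly
    in [n]. Then [kap n * A (x n) u] is bounded, so a weak cluster point [z] lies in the kernel of
    [A]. Testing with [x n - z] upgrades this to convergence in energy. *)
Lemma resolvent_limit (v : V) (lam : R) (kap : nat -> R) : 0 <= lam ->
  kap n @[n --> \oo] --> +oo ->
  exists (x : nat -> V) z, [/\
    forall n u, G (x n) u + kap n * A (x n) u + lam * dot (x n) u = lam * dot v u,
    forall u, A z u = 0,
    forall h, (forall u, A h u = 0) -> G z h + lam * dot z h = lam * dot v h &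
    B (x n - z) (x n - z) @[n --> \oo] --> (0 : R)].
Proof.
move=> lam0 kapoo.
pose F n u w := (G u w + kap n * A u w) + lam * dot u w.
have bF n : bilin (F n).
  by apply: bilinD (bilinD bG (bilinZ _ bA)) (bilinZ _ (si_bilin hdot)).
have BF n : bounded_by B (F n).
  apply: bounded_byD; last exact: bounded_byZ.
  by apply: bounded_byD => //; exact: bounded_byZ.
have FB n u : B u u + lam * dot u u = F n u u by rewrite /F GB A0 mulr0 addr0.
have /choice[x hx] : forall n, exists y, forall u, F n y u = lam * dot v u.
  move=> n; apply: (lax_milgram hB (bF n) (BF n)).
    by move=> u; rewrite -FB lerDl mulr_ge0// (si_ge0 hdot).
  by apply: dualZ; apply: (bilin_dualr hB) => //; exact: (si_bilin hdot).
pose M := lam ^+ 2 * dot v v.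
have M0 : 0 <= M by rewrite mulr_ge0 ?sqr_ge0 ?(si_ge0 hdot).
have xM n : B (x n) (x n) <= M.
  apply: sqr_le_self => //.
  have h1 : B (x n) (x n) <= lam * dot v (x n).
    by rewrite -(hx n) -FB lerDl mulr_ge0// (si_ge0 hdot).
  have h2 : (lam * dot v (x n)) ^+ 2 <= M * B (x n) (x n).
    rewrite exprMn /M -(mulrA _ (dot v v)); apply: (ler_wpM2l (sqr_ge0 lam)).
    apply: le_trans (cauchy_schwarz hdot _ _) _.
    by apply: ler_wpM2l; [exact: (si_ge0 hdot)|exact: dotB].
  apply: le_trans h2; rewrite lerXn2r ?nnegrE ?(si_ge0 hB)//.
  exact: le_trans (si_ge0 hB _) h1.
have dualM l : dual B l -> exists C, forall n, `|l (x n)| <= C.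
  move=> [_ [K K0 hK]]; exists (K * M + 1) => n.
  have h : l (x n) ^+ 2 <= K * M.
    by apply: le_trans (hK _) _; exact: ler_wpM2l.
  have := sqr_ge0 (`|l (x n)| - 1).
  rewrite sqrrB real_normK ?num_real// expr1n mulr1.
  have := normr_ge0 (l (x n)); lra.
have dG u : dual B (G^~ u) by exact: (bilin_duall hB).
have ddot u : dual B (dot^~ u) by apply: (bilin_duall hB) => //; exact: (si_bilin hdot).
have dA u : dual B (A^~ u) by exact: (bilin_duall hB).
have Ax u : A (x n) u @[n --> \oo] --> (0 : R).
  have [C hC] := dualM _ (dualD (dG u) (dualZ lam (ddot u))).
  apply: (@cvg0_mul_bounded kap _ (`|lam * dot v u| + C)) => // n.
  have -> : kap n * A (x n) u = lam * dot v u - (G (x n) u + lam * dot (x n) u).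
    by rewrite -(hx n) /F; ring.
  by apply: le_trans (ler_normB _ _) _; rewrite lerD2l.
have [z [_ hz]] := bounded_weak_cluster hB xM.
have Az u : A z u = 0 by exact: (hz (A^~ u) 0).
(* For [h] in the kernel, [A (x n) h = - A h (x n) = 0], and the term with the factor [kap n] drops
   out. *)
have Gz h : (forall u, A h u = 0) -> G z h + lam * dot z h = lam * dot v h.
  move=> Ah; apply: (hz (fun y => G y h + lam * dot y h)).
    by apply: dualD => //; exact: dualZ.
  apply: cvg_near_cst; apply: nearW => n.
  by rewrite -(hx n) /F (A_anti (x n)) Ah oppr0 mulr0 addr0.
exists x, z; split=> //.
(* Because [A z = 0], [l] is the functional [F n (x n - z)] for every [n]. It vanishes on the kernel
   of [A] by [Gz], so [weak_vanish] applies with the functionals [A u]. *)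
pose l y := lam * dot v y + (-1) * (G z y + lam * dot z y).
have xz n : B (x n - z) (x n - z) <= l (x n - z).
  have : B (x n - z) (x n - z) <= F n (x n - z) (x n - z).
    by rewrite -FB lerDl mulr_ge0// (si_ge0 hdot).
  rewrite (scalfB ((bF n).2 _)) hx /l /F Az; lra.
have lxz : l (x n - z) @[n --> \oo] --> (0 : R).
  apply: (@weak_vanish _ _ _ hB (range A) _ _ (2 * M + 2 * B z z)).
  - move=> n; apply: le_trans (semi_innerD_le hB _ _) _.
    by rewrite (semi_innerN hB) lerD2r ler_pM2l.
  - apply: dualD.
      by apply: dualZ; apply: (bilin_dualr hB) => //; exact: (si_bilin hdot).
    apply: dualZ; apply: dualD; first exact: (bilin_dualr hB).
    by apply: dualZ; apply: (bilin_dualr hB) => //; exact: (si_bilin hdot).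
  - by move=> _ [u _ <-]; exact: (bilin_dualr hB).
  - move=> _ [u _ <-].
    have -> : (fun n => A u (x n - z)) = (fun n => - A (x n) u).
      apply/funext => n; rewrite A_anti (scalfB (bA.2 _)) Az; ring.
    by rewrite -oppr0; exact: cvgN.
  - move=> y Ay; have {}Ay u : A y u = 0.
      by rewrite A_anti Ay ?oppr0//; exists u.
    by rewrite /l (Gz y Ay); ring.
apply: (@squeeze_cvgr _ _ _ _ (cst 0) (fun n => l (x n - z))) => //.
- by apply: nearW => n; rewrite (si_ge0 hB) xz.
- exact: cvg_cst.
Qed.

(** Testing with [x k = z k - v] gives [B (x k) (x k) + k * dot (x k) (x k) = - G v (x k)]. This
    bounds the energy and sends [dot (x k) (x k)] to 0. The functionals [dot u] separate points, so
    [weak_vanish] sends the right-hand side to 0 as well. *)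
Lemma resolvent_approx (v : V) (z : nat -> V) :
  (forall u, A v u = 0) -> (forall k u, A (z k) u = 0) ->
  (forall k h, (forall u, A h u = 0) ->
    G (z k) h + k%:R * dot (z k) h = k%:R * dot v h) ->
  B (z k - v) (z k - v) @[k --> \oo] --> (0 : R).
Proof.
move=> Av Az Gz; pose x k := z k - v.
have Ax k u : A (x k) u = 0 by rewrite (scalfB (bA.2 _)) Az Av subrr.
have Gx k : B (x k) (x k) + k%:R * dot (x k) (x k) = - G v (x k).
  rewrite -GB {1 3}/x (scalfB (bG.2 _)) (scalfB ((si_bilin hdot).2 _)).
  have := Gz k _ (Ax k); lra.
have kd k : 0 <= k%:R * dot (x k) (x k) by rewrite mulr_ge0 ?ler0n ?(si_ge0 hdot).
have xG k : B (x k) (x k) <= - G v (x k) by rewrite -Gx lerDl.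
have [K K0 hK] := BG.
pose M := K * B v v.
have M0 : 0 <= M by rewrite mulr_ge0// (si_ge0 hB).
have xM k : B (x k) (x k) <= M.
  apply: sqr_le_self => //; apply: le_trans (hK v (x k)).
  rewrite -[leRHS]sqrrN lerXn2r ?nnegrE ?(si_ge0 hB)//.
  exact: le_trans (si_ge0 hB _) (xG k).
have GM k : - G v (x k) <= M.
  apply: le_trans (ler_norm _) _.
  rewrite -(@ler_pXn2r _ 2) ?nnegrE// normrN real_normK ?num_real//.
  by apply: le_trans (hK _ _) _; rewrite expr2; exact: ler_wpM2l.
have dx : dot (x k) (x k) @[k --> \oo] --> (0 : R).
  apply: (@cvg0_mul_bounded (fun k => k%:R) _ M); first exact: cvgr_idn.
  by move=> k; rewrite ger0_norm// (le_trans _ (GM k))// -Gx lerDr (si_ge0 hB).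
have Gvx : G v (x k) @[k --> \oo] --> (0 : R).
  apply: (@weak_vanish _ _ _ hB (range dot) _ _ M) => //.
  - exact: (bilin_dualr hB).
  - by move=> _ [u _ <-]; apply: (bilin_dualr hB) => //; exact: (si_bilin hdot).
  - move=> _ [u _ <-].
    have du := bilin_dualr hdot (si_bilin hdot) (bounded_by_self hdot) u.
    have := @dual_cvg _ _ _ hdot _ x 0 du; rewrite (scalf0 du.1); apply.
    by under eq_cvg do rewrite subr0.
  - move=> y dy; rewrite (dot_def (u := y)) ?(scalf0 (bG.1 _))//.
    by apply: dy; exists y.
apply: (@squeeze_cvgr _ _ _ _ (cst 0) (fun k => - G v (x k))).
- by apply: nearW => k; rewrite (si_ge0 hB) xG.
- exact: cvg_cst.
- by rewrite -oppr0; exact: cvgN.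
Qed.

(* [x n] is bounded in energy and asymptotically in the kernel of [A]. *)
Lemma perturbed_bounded (x : nat -> V) (kap : nat -> R) (C : R) : 0 <= C ->
  kap n @[n --> \oo] --> +oo ->
  (forall n v, B v v = 1 -> G v (x n) + kap n * A v (x n) <= C) ->
  exists z, (forall u, A z u = 0) /\
    forall l c, dual B l -> l (x n) @[n --> \oo] --> c -> l z = c.
Proof.
move=> C0 kapoo hx.
have xC n : B (x n) (x n) <= C ^+ 2.
  have [->|b0] := eqVneq (B (x n) (x n)) 0; first exact: sqr_ge0.
  have bpos : 0 < B (x n) (x n) by rewrite lt0r b0 (si_ge0 hB).
  pose s := Num.sqrt (B (x n) (x n)).
  have s0 : 0 < s by rewrite sqrtr_gt0.
  have sE : B (x n) (x n) = s ^+ 2 by rewrite sqr_sqrtr// ltW.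
  (* Testing with the normalized [x n] itself removes [A] and leaves [s <= C]. *)
  have := hx n (s^-1 *: x n).
  rewrite (semi_innerZ hB) (scalfZ (bG.2 _)) (scalfZ (bA.2 _)) A0 GB sE.
  rewrite exprVn mulVf ?gt_eqF ?exprn_gt0// => /(_ erefl).
  rewrite !mulr0 addr0 expr2 mulrA mulVf ?gt_eqF// mul1r => sC.
  by rewrite -expr2 lerXn2r ?nnegrE// ltW.
have dA u : dual B (A u) by exact: (bilin_dualr hB).
have [K K0 hK] := BG.
have A1 v : B v v = 1 -> A v (x n) @[n --> \oo] --> (0 : R).
  move=> v1; apply: (@cvg0_mul_bounded kap _ (C + (K * C ^+ 2 + 1))) => // n.
  have g2 : G v (x n) ^+ 2 <= K * C ^+ 2.
    by apply: le_trans (hK _ _) _; rewrite v1 mulr1; exact: ler_wpM2l.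
  have h1 := hx n v v1.
  (* Together with the bound at [v], this bounds [kap n * A v (x n)] on both sides; [G v (x n)] is
     controlled by [2 * |g| <= g ^+ 2 + 1]. *)
  have := hx n (- v); rewrite (semi_innerN hB) => /(_ v1).
  rewrite (scalfN (bG.2 _)) (scalfN (bA.2 _)) => h2.
  have := sqr_ge0 (G v (x n) - 1); have := sqr_ge0 (G v (x n) + 1).
  rewrite sqrrB sqrrD expr1n mulr1 ler_norml => q1 q2.
  by apply/andP; split; lra.
have Ax v : A v (x n) @[n --> \oo] --> (0 : R).
  have [/(hi_def hB) v0|b0] := eqVneq (B v v) 0.
    rewrite v0; apply: cvg_near_cst; apply: nearW => n.
    by rewrite (scalf0 (bA.2 _)).
  have bpos : 0 < B v v by rewrite lt0r b0 (si_ge0 hB).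
  pose s := Num.sqrt (B v v).
  have s0 : 0 < s by rewrite sqrtr_gt0.
  have sv : B (s^-1 *: v) (s^-1 *: v) = 1.
    by rewrite (semi_innerZ hB) exprVn sqr_sqrtr ?(si_ge0 hB)// mulVf.
  have -> : (fun n => A v (x n)) = (fun n => s * A (s^-1 *: v) (x n)).
    by apply/funext => n; rewrite (scalfZ (bA.2 _)) mulrA mulfV ?gt_eqF// mul1r.
  by rewrite -(mulr0 s); exact: (cvgM (cvg_cst s) (A1 _ sv)).
have [z [_ hz]] := bounded_weak_cluster hB xC.
exists z; split=> // u; rewrite A_anti (hz (A u) 0) ?oppr0//.
Qed.

End perturbation.

(** * The Hilbert space L2 and its image under a map *)

Section L2_inner_product.
Context d (T : measurableType d) (R : realType).
Variable mu : {measure set T -> \bar R}.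
Notation L2 := (LspaceType2 mu).
Implicit Types u v w : L2.

Lemma L2_measurable u : measurable_fun setT (u : T -> R).
Proof. by have := LspaceP u; rewrite LfunE => /asboolP[]. Qed.

Lemma L2_integrable_mul u v :
  mu.-integrable setT (EFin \o (fun x => u x * v x)).
Proof. by apply/Lfun1_integrable/Lfun2_mul_Lfun1; exact: LspaceP. Qed.

Lemma ae_eq_Rintegral (f g : T -> R) : measurable_fun setT f ->
  measurable_fun setT g -> f = g %[ae mu] -> \int[mu]_x f x = \int[mu]_x g x.
Proof.
move=> mf mg fg; rewrite /Rintegral; congr fine; apply: ae_eq_integral => //.
- exact/measurable_EFinP.
- exact/measurable_EFinP.
- by apply: filterS fg => x /= fgx /fgx ->.
Qed.

Lemma L2dot_semi_inner : semi_inner (@L2dot _ _ _ mu).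
Proof.
have sym u v : L2dot u v = L2dot v u.
  by apply: eq_Rintegral => x _; rewrite mulrC.
have lin w : scalar (fun u => L2dot u w).
  move=> a u v; rewrite /L2dot.
  rewrite -RintegralZl//; last exact: L2_integrable_mul.
  rewrite -RintegralD//; last exact: L2_integrable_mul; last first.
    exact: (integrableZl measurableT a (L2_integrable_mul u w)).
  apply: ae_eq_Rintegral.
  - by apply: measurable_funM; exact: L2_measurable.
  - apply: measurable_funD; last by apply: measurable_funM; exact: L2_measurable.
    by apply: measurable_funM => //; apply: measurable_funM; exact: L2_measurable.
  - have h1 := Lspace_addE (a *: u) v; have h2 := Lspace_scaleE a u.
    apply: filterS2 h1 h2 => x /(_ I) + /(_ I) h2 _.
    by move=> ->; rewrite fctE h2 !fctE mulrDl mulrA.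
split=> //; last by move=> u; apply: Rintegral_ge0 => x _; rewrite -expr2 sqr_ge0.
by split=> // w a u v; rewrite ![L2dot w _]sym lin.
Qed.

Lemma L2dot_eq0 u : L2dot u u = 0 -> u = 0.
Proof.
move=> u0; apply/Lspace_eqP.
have i2 := L2_integrable_mul u u.
have : (\int[mu]_x `|(u x * u x)%:E| = 0)%E.
  have -> : (\int[mu]_x `|(u x * u x)%:E| = \int[mu]_x (u x * u x)%:E)%E.
    apply: eq_integral => x _.
    by rewrite gee0_abs// lee_fin -expr2 sqr_ge0.
  rewrite -[LHS]fineK; first by rewrite -[fine _]/(L2dot u u) u0.
  exact: (integrable_fin_num measurableT i2).
move/(ae_eq_integral_abs mu measurableT (measurable_int mu i2)) => h.
apply: filterS2 h (Lspace_zeroE mu (lee1n 2)) => x /= /(_ I) [ux] /(_ I) -> _.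
by move/eqP: ux; rewrite mulf_eq0 orbb => /eqP.
Qed.

Lemma L2norm_cvg0 (x : nat -> L2) :
  L2norm (x n) @[n --> \oo] --> (0 : R) <-> L2dot (x n) (x n) @[n --> \oo] --> (0 : R).
Proof.
have d0 := si_ge0 L2dot_semi_inner; split=> h.
  have -> : (fun n => L2dot (x n) (x n)) = (fun n => L2norm (x n) * L2norm (x n)).
    by apply/funext => n; rewrite /L2norm -expr2 sqr_sqrtr.
  by rewrite -(mulr0 0); exact: cvgM.
by rewrite -(sqrtr0 R); apply: (cvg_comp _ _ h); exact: sqrt_continuous.
Qed.

End L2_inner_product.

(** * Composition with the map as a linear isometry *)

Section L2_image.
Context d d' (T : measurableType d) (T' : measurableType d') (R : realType).
Variables (mu : {measure set T -> \bar R}) (phi : {mfun T >-> T'}).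
Notation nu := (image_measure mu phi).
Implicit Types f g : LspaceType2 nu.

(** The preimage of a null set is null by definition of the image measure. *)
Lemma ae_eq_image (f g : T' -> R) : f = g %[ae nu] -> f \o phi = g \o phi %[ae mu].
Proof.
move=> [N [mN N0 sN]]; exists (phi @^-1` N); split => //.
- by rewrite -[X in measurable X]setTI; exact: measurable_funPT.
- by move=> x /= nfg; apply: sN => /= fg; apply: nfg.
Qed.

Lemma L2comp_linear : linear (@L2comp _ _ _ _ R mu phi).
Proof.
move=> a f g; apply/Lspace_eqP.
have h1 := L2compE (a *: f + g); have h2 := L2compE f; have h3 := L2compE g.
have h4 := Lspace_addE (a *: L2comp f) (L2comp g).
have h5 := Lspace_scaleE a (L2comp f).
have h6 := ae_eq_image (Lspace_addE (a *: f) g).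
have h7 := ae_eq_image (Lspace_scaleE a f).
apply: filterS3 (filterI h1 (filterI h2 h3)) (filterI h4 h5) (filterI h6 h7).
move=> x [/(_ I) e1 [/(_ I) e2 /(_ I) e3]] [/(_ I) e4 /(_ I) e5].
move=> [/(_ I) /= e6 /(_ I) /= e7] _.
apply: etrans e1 _; apply: etrans e6 _; apply/esym; apply: etrans e4 _.
transitivity (a * f (phi x) + g (phi x)).
  exact: (f_equal2 +%R (etrans e5 (f_equal ( *%R a) e2)) e3).
exact: (f_equal (fun y => y + g (phi x)) (esym e7)).
Qed.

Lemma L2dot_comp f g : L2dot (L2comp f) (L2comp g) = L2dot f g.
Proof.
have mphi : measurable_fun setT phi by exact: measurable_funPT.
have mf := L2_measurable f; have mg := L2_measurable g.
have mfg : measurable_fun setT (fun x => f x * g x) by exact: measurable_funM.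
transitivity (\int[mu]_x (f (phi x) * g (phi x))).
  apply: ae_eq_Rintegral.
  - by apply: measurable_funM; exact: L2_measurable.
  - exact: (measurableT_comp mfg mphi).
  - by apply: filterS2 (L2compE f) (L2compE g) => x /(_ I) -> /(_ I) ->.
rewrite /L2dot /Rintegral; congr fine.
rewrite [RHS](integral_pushforward mphi) ?preimage_setT//.
- exact/measurable_EFinP.
- apply/Lfun1_integrable.
  by apply: (Lfun2_mul_Lfun1 (L2comp_subproof f) (L2comp_subproof g)).
Qed.

End L2_image.

(** Turns a bound on the lower limit into a bound along a subsequence. *)
Lemma limn_einf_lty (R : realType) (u : nat -> \bar R) :
  (limn_einf u < +oo)%E -> exists2 C : R, 0 <= C &
    forall N, exists2 n, (N <= n)%N & (u n <= C%:E)%E.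
Proof.
rewrite limn_einf_lim (cvg_lim _ (@cvg_einfs_sup _ u))//.
set S := ereal_sup _ => Soo.
have [C C0 SC] : exists2 C : R, 0 <= C & (S < C%:E)%E.
  (* The lower limit may be [-oo], and then the constant 0 serves. *)
  move: S Soo => [r _| |_]//; last by exists 0; rewrite ?ltNyr.
  exists (`|r| + 1); first by rewrite addr_ge0.
  by rewrite lte_fin (le_lt_trans (ler_norm _))// ltrDl.
exists C => // N.
have : (einfs u N < C%:E)%E.
  by apply: le_lt_trans SC; apply: ereal_sup_ubound; exists N.
by move=> /ereal_inf_lt[_ [n /= Nn <-] /ltW unC]; exists n.
Qed.

(* For each [n] the index [s n] nearly minimizes [p ^~ n]. *)
Lemma diagonal_cvg0 (R : realType) (p : nat -> nat -> R) :
  (forall k n, 0 <= p k n) ->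
  (forall e, 0 < e -> exists k, \forall n \near \oo, p k n < e) ->
  exists s : nat -> nat, p (s n) n @[n --> \oo] --> (0 : R).
Proof.
move=> p0 pe.
have /choice[s hs] : forall n, exists k, forall j, p k n < p j n + n.+1%:R^-1.
  move=> n.
  have hi : has_inf (range (p^~ n)).
    by split; [exists (p 0%N n), 0%N | exists 0 => _ [k _ <-]].
  have [|_ [k _ <-] hk] := @inf_adherent _ _ n.+1%:R^-1 _ hi.
    by rewrite invr_gt0 ltr0n.
  exists k => j; apply: lt_le_trans hk _; rewrite lerD2r.
  by apply: ge_inf; [exact: hi.2|exists j].
exists s; apply/cvgrPdist_lt => e e0.
have e2 : 0 < e / 2 by rewrite divr_gt0.
have [k hk] := pe _ e2.
have /cvgrPdist_lt/(_ _ e2) hh := @cvg_harmonic R.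
apply: filterS2 hk hh => n kn; rewrite !sub0r !normrN (ger0_norm (harmonic_ge0 _)) => hn.
rewrite ger0_norm// [ltRHS]splitr; apply: lt_trans (hs n k) _.
by rewrite ltrD.
Qed.

(** * Mosco convergence *)

Section submodule_type.
Context (R : realType) (V : lmodType R) (H : set V).
Hypothesis H_closed : H 0 /\ forall a u v, H u -> H v -> H (a *: u + v).

Definition submodule_pred of (H 0 /\ forall a u v, H u -> H v -> H (a *: u + v)) :
  {pred V} := fun x => `[< H x >].

Fact submodule_pred_closed : submod_closed (submodule_pred H_closed).
Proof.
split; first by apply/asboolP; exact: H_closed.1.
by move=> a u v /asboolP Hu /asboolP Hv; apply/asboolP; exact: H_closed.2.
Qed.

HB.instance Definition _ :=
  GRing.isSubmodClosed.Build R V (submodule_pred H_closed) submodule_pred_closed.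

(** Makes the form domain a module in its own right, so that forms constrained only on [H] become
    total forms to which the abstract results apply. *)
Definition submodule := {x : V | x \in submodule_pred H_closed}.

HB.instance Definition _ := SubChoice.on submodule.
HB.instance Definition _ := [SubChoice_isSubLmodule of submodule by <:].

Lemma submoduleP (x : submodule) : H (val x).
Proof. by apply/asboolP; exact: (valP x). Qed.

Definition in_submodule x (Hx : H x) : submodule := exist _ x (asboolT Hx).

Lemma submodule_linear a (x y : submodule) : val (a *: x + y) = a *: val x + val y.
Proof. by []. Qed.

Lemma submoduleB (x y : submodule) : val (x - y) = val x - val y.
Proof. by []. Qed.

End submodule_type.

(** * The two Mosco conditions for the perturbed forms *)

Section mosco_convergence.
Context d d' (T : measurableType d) (T' : measurableType d') (R : realType).
Variables (mu : {measure set T -> \bar R}) (phi : {mfun T >-> T'}).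
Notation L2T := (LspaceType2 mu).
Notation nu := (image_measure mu phi).
Notation J := (@L2comp _ _ _ _ R mu phi).
Variables (H : set L2T) (E Ea : L2T -> L2T -> R) (a0 : R).
Hypothesis hE : bilinear_closed_form H E a0.
Hypotheses (Ea_bilin : bilinear_on H Ea) (Ea_anti : antisymmetric_on H Ea).
Hypothesis Ea_bound : exists K : R, forall u v, H u -> H v ->
  `|Ea u v| <= K * Num.sqrt (form_shift (a0 + 1) E u u)
                 * Num.sqrt (form_shift (a0 + 1) E v v).
Hypothesis Ea_kernel : forall u, H u -> (forall v, H v -> Ea u v = 0) <->
  (exists2 f : LspaceType2 nu, image_domain H f & u = J f).
Variable kap : nat -> R.
Hypothesis kap_oo : kap n @[n --> \oo] --> +oo.

Notation D := (submodule (bcf_domain hE)).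
Let B (x y : D) := form_shift (a0 + 1) (sym_part E) (val x) (val y).
Let dot (x y : D) := L2dot (val x) (val y).
Let G (x y : D) := form_shift (a0 + 1) E (val x) (val y).
Let A (x y : D) := Ea (val x) (val y).

Let L2dotl (u : L2T) : scalar (L2dot u) := (si_bilin (L2dot_semi_inner mu)).1 u.
Let L2dotr (u : L2T) : scalar (@L2dot _ _ _ mu ^~ u) :=
  (si_bilin (L2dot_semi_inner mu)).2 u.

Let bilin_sub F : bilinear_on H F -> bilin (fun x y : D => F (val x) (val y)).
Proof.
move=> [Fl Fr]; split=> w a x y; rewrite submodule_linear.
- by apply: Fr; exact: submoduleP.
- by apply: Fl; exact: submoduleP.
Qed.

Let GB u : G u u = B u u.
Proof. by rewrite /G /B /form_shift /sym_part; field. Qed.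

Let dotD : semi_inner dot.
Proof.
have hd := L2dot_semi_inner mu.
split=> [|u v|u]; [split=> w a x y; rewrite /dot submodule_linear| |].
- exact: L2dotl.
- exact: L2dotr.
- exact: (si_sym hd).
- exact: (si_ge0 hd).
Qed.

Let dotD_def u : dot u u = 0 -> u = 0.
Proof. by move=> /L2dot_eq0 u0; exact: val_inj. Qed.

(** [B] exceeds the form shifted by [a0], which is nonnegative, by exactly one copy of [dot]. *)
Let dotB u : dot u u <= B u u.
Proof.
have := bcf_lower_bound hE (submoduleP u).
by rewrite /B /dot /form_shift; lra.
Qed.

Let B_hilbert : hilbert_inner B.
Proof.
have [[bB sB B0 Bd] Bc] := bcf_hilbert hE.
have BB : semi_inner B.
  split=> [|u v|u]; first exact: bilin_sub.
  - by apply: sB; exact: submoduleP.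
  - by apply: B0; exact: submoduleP.
split=> // [u u0|u Cu].
  by apply: val_inj; apply: Bd => //; exact: submoduleP.
have [|e e0|v Hv uv] := Bc (fun n => val (u n)); first by move=> n; exact: submoduleP.
  (* [complete_on] measures distances by norms and [hilbert_inner] by their squares. *)
  have [N hN] := Cu (e ^+ 2) (exprn_gt0 _ e0); exists N => i j iN jN.
  rewrite -[ltRHS]ger0_norm ?ltW// -sqrtr_sqr ltr_sqrt ?exprn_gt0//.
  by have := hN i j iN jN.
exists (in_submodule (bcf_domain hE) Hv).
set b := (X in X @ _ --> _).
have -> : b = (fun n => Num.sqrt (b n) * Num.sqrt (b n)).
  by apply/funext => n; rewrite -expr2 sqr_sqrtr// (si_ge0 BB).
by rewrite -(mulr0 0); exact: cvgM.
Qed.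

Let bounded_sub F K : (forall u v, H u -> H v ->
    `|F u v| <= K * Num.sqrt (form_shift (a0 + 1) E u u)
                  * Num.sqrt (form_shift (a0 + 1) E v v)) ->
  bounded_by B (fun x y : D => F (val x) (val y)).
Proof.
move=> hK; exists (K ^+ 2) => [|x y]; first exact: sqr_ge0.
have B0 u : 0 <= B u u := si_ge0 B_hilbert u.
have := hK _ _ (submoduleP x) (submoduleP y).
rewrite -![form_shift _ E _ _]/(G _ _) !GB => h.
rewrite -(@real_normK _ (F _ _)) ?num_real//.
rewrite -[X in _ * X * _](sqr_sqrtr (B0 x)) -[X in _ * X](sqr_sqrtr (B0 y)).
by rewrite -!exprMn lerXn2r ?nnegrE// (le_trans _ h).
Qed.

Let bG : bilin G.
Proof.
have [El Er] := bcf_bilinear hE.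
apply: bilin_sub; split=> a u v w Hu Hv Hw; rewrite /form_shift.
- by rewrite El// L2dotr; ring.
- by rewrite Er// L2dotl; ring.
Qed.

Let BG : bounded_by B G.
Proof. by have [K _ hK] := bcf_sector hE; exact: (bounded_sub hK). Qed.

Let bA : bilin A. Proof. exact: bilin_sub. Qed.

Let BA : bounded_by B A.
Proof. by have [K hK] := Ea_bound; exact: (bounded_sub hK). Qed.

Let A_anti u v : A u v = - A v u.
Proof. by apply: Ea_anti; exact: submoduleP. Qed.

Let A_kernel u : (forall v, A u v = 0) ->
  exists2 f, image_domain H f & val u = J f.
Proof.
move=> Au; apply/(Ea_kernel (submoduleP u)) => v Hv.
exact: (Au (in_submodule (bcf_domain hE) Hv)).
Qed.

Let J_kernel f (Hf : H (J f)) v : A (in_submodule (bcf_domain hE) Hf) v = 0.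
Proof. by apply: ((Ea_kernel Hf).2 _) (submoduleP v); exists f. Qed.

Let dual_L2dot (w : L2T) : dual B (fun x => L2dot (val x) w).
Proof.
split; first by move=> a x y; rewrite submodule_linear L2dotr.
exists (L2dot w w) => [|x]; first exact: (si_ge0 (L2dot_semi_inner mu)).
apply: le_trans (cauchy_schwarz (L2dot_semi_inner mu) _ _) _; rewrite mulrC.
by apply: ler_wpM2l; [exact: (si_ge0 (L2dot_semi_inner mu))|exact: dotB].
Qed.

Let strong_cst (Phi := (fun _ : nat => J)) f : strong_cvg Phi (fun=> J f) f.
Proof.
rewrite /strong_cvg; apply: cvg_near_cst; apply: nearW => n.
by rewrite subrr /L2norm (scalf0 (L2dotl _)) sqrtr0.
Qed.

Lemma L2comp_hilbert_cvg : hilbert_cvg (fun=> J).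
Proof.
split=> [_|f]; first exact: L2comp_linear.
by under eq_cvg do rewrite /L2norm L2dot_comp; exact: cvg_cst.
Qed.

(** Along a subsequence with bounded [mosco_Theta], [perturbed_bounded] yields a cluster point in
    the kernel of [A], which is [J g] for some [g] in the image domain; weak convergence identifies
    [g] with [f]. *)
Lemma perturbed_mosco_F1 :
  mosco_F1 (fun=> J) a0 (fun=> H) (fun n => perturbed_form E Ea (kap n))
    (image_domain H).
Proof.
move=> u f Hu wu /limn_einf_lty[C C0 hC].
have /choice[s hs] : forall N, exists n, (N <= n)%N /\
    (mosco_Theta a0 (fun=> H) (fun n => perturbed_form E Ea (kap n)) n (u n) <= C%:E)%E.
  by move=> N; have [n Nn un] := hC N; exists n.
have s_oo : s n @[n --> \oo] --> \oo.
  move=> P [N _ hN]; exists N => // n /= Nn.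
  by apply: hN; exact: leq_trans Nn (hs n).1.
pose x n := in_submodule (bcf_domain hE) (Hu (s n)).
have [n v v1|z [Az zc]] := perturbed_bounded B_hilbert bG BG GB bA BA A_anti
  (x := x) C0 (cvg_comp _ _ s_oo kap_oo).
  (* A [v] with [B v v = 1] competes in the supremum, since antisymmetry makes the perturbed energy
     of [v] equal to [B v v]. *)
  rewrite -lee_fin; apply: le_trans (hs n).2; apply: ereal_sup_ubound.
  exists (val v) => /=; last first.
    by congr EFin; rewrite /G /A /form_shift /perturbed_form/=; ring.
  split; first exact: submoduleP.
  apply: etrans v1; rewrite -GB /form_shift /perturbed_form /G /form_shift.
  have := A_anti v v; rewrite /A => Av.
  by rewrite (_ : Ea (val v) (val v) = 0); [ring|lra].
have [g Hg zg] := A_kernel Az.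
(* Pairing with [J (f - g)] and using that [J] is an isometry shows that [f - g] has norm 0. *)
suff -> : f = g by [].
apply/eqP; rewrite -subr_eq0; apply/eqP/L2dot_eq0.
have hd := L2dot_semi_inner nu.
rewrite (scalfB ((si_bilin hd).2 _)) -(L2dot_comp g) -zg.
apply/eqP; rewrite subr_eq0; apply/eqP/esym.
apply: (zc _ _ (dual_L2dot (J (f - g)))).
exact: (cvg_comp _ _ s_oo (wu _ _ (strong_cst (f - g)))).
Qed.

Lemma perturbed_mosco_F2 :
  mosco_F2 (fun=> J) (fun=> H) (fun n => perturbed_form E Ea (kap n))
    (image_domain H) (image_form E).
Proof.
move=> u f Hu wu Hf g Hg.
pose v := in_submodule (bcf_domain hE) Hg.
pose w := in_submodule (bcf_domain hE) Hf.
have /choice[xz hxz] : forall k : nat, exists xz : (nat -> D) * D, [/\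
    forall n y, G (xz.1 n) y + kap n * A (xz.1 n) y + k%:R * dot (xz.1 n) y
      = k%:R * dot v y,
    forall y, A xz.2 y = 0,
    forall h, (forall y, A h y = 0) -> G xz.2 h + k%:R * dot xz.2 h = k%:R * dot v h &
    B (xz.1 n - xz.2) (xz.1 n - xz.2) @[n --> \oo] --> (0 : R)].
  move=> k; have [x [z h]] := resolvent_limit B_hilbert dotD dotB bG BG GB bA BA
    A_anti v (ler0n R k) kap_oo.
  by exists (x, z).
pose x k := (xz k).1; pose z k := (xz k).2.
have xE k n y : G (x k n) y + kap n * A (x k n) y + k%:R * dot (x k n) y
  = k%:R * dot v y by have [+ _ _ _] := hxz k; apply.
have zA k y : A (z k) y = 0 by have [_ + _ _] := hxz k; apply.
have zE k h : (forall y, A h y = 0) -> G (z k) h + k%:R * dot (z k) h = k%:R * dot v h.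
  by have [_ _ + _] := hxz k; apply.
have xz_cvg k : B (x k n - z k) (x k n - z k) @[n --> \oo] --> (0 : R).
  by have [] := hxz k.
have zv : B (z k - v) (z k - v) @[k --> \oo] --> (0 : R).
  exact: (resolvent_approx B_hilbert dotD dotD_def dotB bG BG GB bA
    (v := v) (J_kernel Hg) zA zE).
have ddot y : dual B (dot^~ y) := dual_L2dot (val y).
(* The form [E] differs from the bounded form [G] by a multiple of the L2 product. *)
have dE : dual B (fun y => E (val y) (J f)).
  have := dualD (bilin_duall B_hilbert bG BG w) (dualZ (- (a0 + 1)) (ddot w)).
  by congr dual; apply/funext => y; rewrite /G /dot /form_shift/=; ring.
have zEf := dual_cvg B_hilbert dE zv.
(* For fixed [k], the resolvent equation tested with [u n] writes the perturbed form as
   [k <u n, J g> - (k + a0 + 1) <u n, x k n>]. Both products converge, because [x k n] converges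
   strongly to [gk]. *)
have xu k : perturbed_form E Ea (kap n) (val (x k n)) (u n) @[n --> \oo] -->
    E (val (z k)) (J f).
  have [gk Hgk zgk] := A_kernel (zA k).
  have xgk : strong_cvg (fun=> J) (fun n => val (x k n)) gk.
    apply/L2norm_cvg0.
    apply: (@squeeze_cvgr _ _ _ _ (cst 0) (fun n => B (x k n - z k) (x k n - z k))).
    - apply: nearW => n; rewrite (si_ge0 (L2dot_semi_inner mu))/= -zgk -submoduleB.
      by rewrite -[leLHS]/(dot _ _) (semi_innerBC dotD).
    - exact: cvg_cst.
    - exact: xz_cvg.
  (* The limit has the same expression, by the equation for [z k] tested with [J f], which lies in
     the kernel. *)
  have -> : E (val (z k)) (J f) =
      k%:R * L2dot f g + - (k%:R + (a0 + 1)) * L2dot f gk.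
    have := zE k w (J_kernel Hf); rewrite /G /dot /form_shift/= zgk.
    rewrite !L2dot_comp !(si_sym (L2dot_semi_inner nu) _ f) => h.
    apply/eqP; rewrite -subr_eq0; apply/eqP.
    by rewrite -[RHS](subrr (k%:R * L2dot f g)) -{1}h; ring.
  have -> : (fun n => perturbed_form E Ea (kap n) (val (x k n)) (u n)) =
      (fun n => k%:R * L2dot (u n) (J g) +
                - (k%:R + (a0 + 1)) * L2dot (u n) (val (x k n))).
    apply/funext => n.
    have := xE k n (in_submodule (bcf_domain hE) (Hu n)).
    rewrite /G /A /dot /perturbed_form /form_shift/=.
    rewrite !(si_sym (L2dot_semi_inner mu) _ (u n)) => h.
    apply/eqP; rewrite -subr_eq0; apply/eqP.
    by rewrite -[RHS](subrr (k%:R * L2dot (u n) (J g))) -{1}h; ring.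
  apply: cvgD; apply: (cvgM (cvg_cst _)).
    exact: (wu _ _ (strong_cst g)).
  exact: (wu _ _ xgk).
(* [a] is the squared L2 error and [b] the error in the form; the diagonal choice makes their sum
   small. *)
pose a k n := L2dot (J g - val (x k n)) (J g - val (x k n)).
pose b k n := `|perturbed_form E Ea (kap n) (val (x k n)) (u n) - E (J g) (J f)|.
have a0' k n : 0 <= a k n by exact: (si_ge0 (L2dot_semi_inner mu)).
have ax k n : a k n <= 2 * B (z k - v) (z k - v) + 2 * B (x k n - z k) (x k n - z k).
  have -> : a k n = dot ((v - z k) + (z k - x k n)) ((v - z k) + (z k - x k n)).
    by rewrite addrA subrK.
  apply: le_trans (semi_innerD_le dotD _ _) _.
  rewrite (semi_innerBC dotD v) (semi_innerBC dotD (z k) (x k n)).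
  by have := dotB (z k - v); have := dotB (x k n - z k); lra.
have [k n|e e0|s hs] := @diagonal_cvg0 _ (fun k n => a k n + b k n).
- by rewrite addr_ge0// normr_ge0.
(* The budget is [2 * (e / 8) + 2 * (e / 8)] for [a] and [e / 4 + e / 4] for [b]; [k] is fixed
   before [n]. *)
- have e4 : 0 < e / 4 by rewrite divr_gt0.
  have e8 : 0 < e / 8 by rewrite divr_gt0.
  have /cvgrPdist_lt/(_ _ e8)[N1 _ h1] := zv.
  have /cvgrPdist_lt/(_ _ e4)[N2 _ h2] := zEf.
  exists (maxn N1 N2); set k := maxn N1 N2.
  have /cvgrPdist_lt/(_ _ e8) h3 := xz_cvg k.
  have /cvgrPdist_lt/(_ _ e4) h4 := xu k.
  have {}h1 := h1 k (leq_maxl _ _); have {}h2 := h2 k (leq_maxr _ _).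
  apply: filterS2 h3 h4 => n; move: h1 h2.
  rewrite !sub0r !normrN !(ger0_norm (si_ge0 B_hilbert _)) => h1 h2 h3 h4.
  have : b k n < e / 4 + e / 4.
    apply: le_lt_trans (ler_distD (E (val (z k)) (J f)) _ _) _.
    by rewrite ltrD// distrC.
  have := ax k n; lra.
exists (fun n => val (x (s n) n)); split.
- by move=> n; exact: submoduleP.
- apply/L2norm_cvg0; apply: (@squeeze_cvgr _ _ _ _ (cst 0) _ _ _ _ _ hs).
  + by apply: nearW => n; rewrite a0' lerDl normr_ge0.
  + exact: cvg_cst.
- apply/cvgrPdist_lt => e e0; move/cvgrPdist_lt : hs => /(_ _ e0).
  apply: filterS => n; rewrite sub0r normrN ger0_norm ?addr_ge0 ?normr_ge0//.
  by apply: le_lt_trans; rewrite distrC lerDr.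
Qed.

End mosco_convergence.

Unset Implicit Arguments.

Theorem theorem3p13 (R : realType) (M Mt : pmetricType R)
  (M_lc : locally_compact [set: M]) (M_sep : separable_space M)
  (m : {measure set (borel M) -> \bar R})
  (m_radon : radon_measure m) (m_supp : measure_supp m = [set: M])
  (a0 : R) (H : set (LspaceType2 m))
  (E : LspaceType2 m -> LspaceType2 m -> R)
  (E_dirichlet : dirichlet_form H E a0)
  (Ea : LspaceType2 m -> LspaceType2 m -> R)
  (Ea_bilinear : bilinear_on H Ea) (Ea_anti : antisymmetric_on H Ea)
  (Ea_bound : exists K : R, forall u v, H u -> H v ->
     `|Ea u v| <= K * Num.sqrt (form_shift (a0 + 1) E u u)
                    * Num.sqrt (form_shift (a0 + 1) E v v))
  (Mt_lc : locally_compact [set: Mt]) (Mt_sep : separable_space Mt)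
  (pi : {mfun borel M >-> borel Mt})
  (mt_supp : measure_supp (image_measure m pi) = [set: Mt])
  (Ht_dense : L2dense (image_domain (phi := pi) H))
  (Ea_kernel : forall u, H u ->
     (forall v, H v -> Ea u v = 0) <->
     (exists2 ut : LspaceType2 (image_measure m pi),
        image_domain H ut & u = L2comp ut)) :
  forall kappa : nat -> R,
    nondecreasing_seq kappa -> kappa n @[n --> \oo] --> +oo ->
    mosco_cvg (fun=> @L2comp _ _ _ _ R m pi) a0
      (fun=> H) (fun n => perturbed_form E Ea (kappa n))
      (image_domain H) (image_form E).
Proof.
move=> kappa _ kappa_oo; have hE := df_closed E_dirichlet; split.
- exact: L2comp_hilbert_cvg.
- exact: (perturbed_mosco_F1 hE).
- exact: (perturbed_mosco_F2 hE).
Qed.
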